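(* Let $\Gamma$ be a ribbon graph of a connected trivalent graph $G(V,E)$, let $n\in\mathbb{N}$ and $\nu\in\{0,1\}^V$. The harmonic colorings of $\widehat{\mathcal{VCH}}_n(\Gamma_\nu)$, i.e. the color basis elements $c_I$ lying in $\widehat{\mathcal{VCH}}_n(\Gamma_\nu)$, are in one-to-one correspondence with the partial $n$-face colorings of the state graph $\Gamma_\nu$. Furthermore, each partial $n$-face coloring induces a matching set $M\subset E$ such that 1. when the coloring is a proper $n$-face coloring at every vertex of $G$, then $M=\emptyset$, and 2. when the coloring is a partial $n$-face coloring at every vertex of $G$ (exactly two colors at each vertex), then $M$ is a perfect matching.
   Context: Graphs are finite multigraphs: loops and multiple edges are allowed, and so are ''vertex-less'' edges (circles, also regarded as loops). Trivalent means every vertex has degree 3 (a loop at a vertex counts twice). A perfect matching is a set of non-loop edges such that each vertex is incident to exactly one of them. Ribbon graphs. A ribbon graph $\Gamma$ of $G$ is a surface with boundary in which $G$ is embedded and which deformation retracts onto $G$; combinatorially, a disc for each vertex and a band for each edge, with a cyclic order of half-edges at each vertex and possibly half-twisted bands (a vertex-less edge gives an annulus or Möbius band). Faces are the discs capping its boundary circles. States. Let $H$ be the set of half-edges (pairs of an edge and one of its ends at a vertex). For $\alpha\in\{0,1\}^H$, $\Gamma_\alpha$ is obtained from $\Gamma$ by inserting, for each $h$ with $\alpha_h=1$, one half-twist in the band of the edge containing $h$. For $\nu\in\{0,1\}^V$ let $\alpha(\nu)_h=\nu_v$ where $v$ is the vertex of $h$; the state graph $\Gamma_\nu$ is the ribbon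 graph $\Gamma_{\alpha(\nu)}$; $|\nu|=\sum_v\nu_v$. Circles of a state are its boundary circles (equivalently, its faces). Filtered complex. Let $m=n/2$ if $n$ is even, $m=(n-1)/2$ if $n$ is odd, $\widehat A=\mathbb{C}[x]/(x^n-1)$, with $\widehat\mu$ the multiplication, $\widehat\Delta(x^k)=\sum_{0\le i,j<n,\ i+j\equiv k+2m\ (n)}x^i\otimes x^j$, $\widehat\eta(x^k)=\sqrt n\,x^{k+m}$. Put $\widehat A_\alpha=\widehat A^{\otimes(\text{circles of }\Gamma_\alpha)}$. If $\alpha'$ is obtained from $\alpha$ by changing one coordinate from 0 to 1, the half-twist merges two circles, splits one circle into two, or changes one circle to one circle; $\widehat\partial_{\alpha\alpha'}$ applies $\widehat\mu,\widehat\Delta,\widehat\eta$ respectively on affected factors and the identity elsewhere. If $\nu'$ is obtained from $\nu$ by changing one coordinate from 0 to 1, $\widehat\delta_{\nu\nu'}:\widehat V_\nu\to\widehat V_{\nu'}$, with $\widehat V_\nu:=\widehat A_{\alpha(\nu)}$, is the composition of three maps $\widehat\partial$ along any 3-step path from $\alpha(\nu)$ to $\alpha(\nu')$ (independent of the path). Ordering $V$, $\widehat C_n^i(\Gamma)=\bigoplus_{|\nu|=i}\widehat V_\nu$ and $\widehat\delta=\sum_{\nu'}(-1)^s\widehat\delta_{\nu\nu'}$ on $\widehat V_\nu$, with $s$ the number of 1's of $\nu$ before the changed coordinate. Colors and harmonic elements. With $\lambda=e^{2\pi \mathrm{i}/n}$, the color basis of $\widehat A$ is $c_i=\frac1n\sum_{k=0}^{n-1}\lambda^{ki}x^k$,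 $0\le i\le n-1$. For an assignment $I$ of elements of $\{0,\dots,n-1\}$ to the circles of $\Gamma_\nu$, $c_I\in\widehat V_\nu$ is the tensor product of the corresponding $c_i$; the $c_I$ form a basis of $\widehat V_\nu$. Give $\widehat C_n^*(\Gamma)$ the Hermitian metric for which all the $c_I$ (over all states) are orthonormal, and let $\widehat\delta^*:\widehat C_n^i\to\widehat C_n^{i-1}$ be the adjoint of $\widehat\delta$. Then $\widehat{\mathcal{VCH}}_n(\Gamma_\nu):=\ker(\widehat\delta|_{\widehat V_\nu})\cap\ker(\widehat\delta^*|_{\widehat V_\nu})$. Face colorings. Given an assignment of colors $\{0,\dots,n-1\}$ to the faces of $\Gamma_\nu$, it is a proper (resp. partial) $n$-face coloring at a vertex $v$ if exactly three (resp. exactly two) distinct colors occur among the faces incident to $v$ (at its three corners). It is a partial $n$-face coloring (of $\Gamma_\nu$) if at each vertex it is proper or partial. Its induced matching set $M\subset E$ is the set of edges such that the face(s) on the two sides of the edge in $\Gamma_\nu$ have the same color.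
   Formalization: Items 1 and 2 are stated for graphs G with at least one vertex: for G a single vertex-less circle and Γ an annulus with both faces the same color, the vertex conditions are vacuous while M contains the circle, a loop. The correspondence itself is stated for every G. *)

(* Defs.v *)
From HB Require Import structures.
From mathcomp Require Import all_boot all_order all_algebra all_fingroup.
From mathcomp Require Import boolp classical_sets functions reals trigo.
From mathcomp Require Import complex.

Set Implicit Arguments.
Unset Strict Implicit.
Unset Printing Implicit Defensive.

Import Order.TTheory GRing.Theory Num.Theory.
Local Open Scope ring_scope.

(* The two half-edges of an edge e with end vertices are (e, false) and
   (e, true), attached at [ends e false] and [ends e true]; [free_edge]
   is the set of vertex-less edges. *)
Record multigraph := Multigraph {
  vert : finType;
  edge : finType;
  free_edge : finType;
  ends : edge -> bool -> vert }.

Definition half_edge (G : multigraph) : finType := (edge G * bool)%type.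

Definition all_edge (G : multigraph) : finType := (edge G + free_edge G)%type.

Definition end_vertex (G : multigraph) (h : half_edge G) : vert G :=
  ends h.1 h.2.

Definition other_half (G : multigraph) (h : half_edge G) : half_edge G :=
  (h.1, ~~ h.2).

Definition halves_at (G : multigraph) (v : vert G) : {set half_edge G} :=
  [set h : half_edge G | end_vertex h == v]%SET.

Definition trivalent (G : multigraph) : Prop :=
  forall v : vert G, #|halves_at v| = 3%N.

(* Connectedness of the underlying space: its pieces are glued from the
   vertices, joined by edges, and from the isolated circles. *)
Definition joined (G : multigraph) : rel (vert G + free_edge G) :=
  fun x y => match x, y with
  | inl u, inl v =>
      [exists h : half_edge G,
         (end_vertex h == u) && (end_vertex (other_half h) == v)]
  | _, _ => false
  end.

Definition connected_graph (G : multigraph) : Prop :=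
  (0 < #|{: vert G + free_edge G}|)%N /\
  forall x y : vert G + free_edge G, connect (@joined G) x y.

Definition is_loop (G : multigraph) (e : all_edge G) : bool :=
  match e with
  | inl e => ends e false == ends e true
  | inr _ => true
  end.

Definition incident (G : multigraph) (v : vert G) (e : all_edge G) : bool :=
  match e with
  | inl e => (ends e false == v) || (ends e true == v)
  | inr _ => false
  end.

Definition perfect_matching (G : multigraph) (M : {set all_edge G}) : Prop :=
  (forall e, e \in M -> ~~ is_loop e) /\
  (forall v : vert G, #|[set e in M | incident v e]%SET| = 1%N).

(* [rot] sends a half-edge to the next one, counterclockwise, around its
   vertex; [twisted] tells which bands carry a half-twist, the band of a
   vertex-less edge being an annulus or a Moebius band. *)
Record ribbon (G : multigraph) := Ribbon {
  rot : {perm half_edge G};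
  rotP : forall h h' : half_edge G,
    fconnect rot h h' = (end_vertex h == end_vertex h');
  twisted : all_edge G -> bool }.

(* A flag is a side of a half-edge: seen from the vertex outwards, [true] is
   the left (counterclockwise) side and [false] the right side. A vertex-less
   edge has two flags, its two local sides. *)
Definition side_flag (G : multigraph) : finType :=
  ((half_edge G + free_edge G) * bool)%type.

(* One step along the boundary: through the corner between h and rot h, along
   a band (an untwisted band joins the left side of h to the right side of
   other_half h), or once around a vertex-less Moebius band. *)
Definition bd_step (G : multigraph) (Gam : ribbon G) : rel (side_flag G) :=
  fun f g => match f, g with
  | (inl h, s), (inl h', s') =>
      [&& h' == rot Gam h, s & ~~ s']
      || [&& h' == other_half h & s' == s (+) ~~ twisted Gam (inl h.1)]
  | (inr o, s), (inr o', s') => [&& o' == o, s' == ~~ s & twisted Gam (inr o)]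
  | _, _ => false
  end.

Definition bd_conn (G : multigraph) (Gam : ribbon G) : rel (side_flag G) :=
  connect (fun f g => bd_step Gam f g || bd_step Gam g f).

Definition bd_class (G : multigraph) (Gam : ribbon G) (f : side_flag G) :
  {set side_flag G} := [set g | bd_conn Gam f g]%SET.

(* Boundary circles (equivalently faces), each given as the set of flags it
   runs through; there are no further ones when every vertex has an edge. *)
Definition circles (G : multigraph) (Gam : ribbon G) :
  {set {set side_flag G}} :=
  [set bd_class Gam f | f : side_flag G]%SET.

Definition circle (G : multigraph) (Gam : ribbon G) : finType :=
  {B : {set side_flag G} | B \in circles Gam}.

Lemma bd_class_in (G : multigraph) (Gam : ribbon G) (f : side_flag G) :
  bd_class Gam f \in circles Gam.
Proof. exact: imset_f. Qed.

Definition circle_of (G : multigraph) (Gam : ribbon G) (f : side_flag G) :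
  circle Gam := exist _ (bd_class Gam f) (bd_class_in Gam f).

Definition hstate (G : multigraph) : finType := {ffun half_edge G -> bool}.

Definition state (G : multigraph) : finType := {ffun vert G -> bool}.

Definition ins_twists (G : multigraph) (Gam : ribbon G) (alpha : hstate G) :
    ribbon G :=
  Ribbon (@rotP G Gam)
    (fun e => match e with
     | inl e' => twisted Gam e (+) (alpha (e', false) (+) alpha (e', true))
     | inr _ => twisted Gam e
     end).

Definition half_edge_state (G : multigraph) (nu : state G) : hstate G :=
  [ffun h : half_edge G => nu (end_vertex h)].

Definition state_graph (G : multigraph) (Gam : ribbon G) (nu : state G) :
  ribbon G := ins_twists Gam (half_edge_state nu).

(* Changes the coordinate x of f to 1. *)
Definition raise_to1 (T : finType) (f : {ffun T -> bool}) (x : T) :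
  {ffun T -> bool} := [ffun y => (y == x) || f y].

(* The algebra C[x]/(x^n - 1) is used in its monomial basis x^k, k < n. The
   maps mu, Delta, eta are given by their matrix coefficients:
   [mu_coef i j k] is the coefficient of x^k in mu(x^i (x) x^j),
   [Delta_coef k i j] that of x^i (x) x^j in Delta(x^k),
   [eta_coef k l] that of x^l in eta(x^k).
   In both parities m is n./2. *)
Definition mu_coef (R : realType) (n : nat) (i j k : 'I_n) : R[i] :=
  (k == i + j %[mod n])%N%:R.

Definition Delta_coef (R : realType) (n : nat) (k i j : 'I_n) : R[i] :=
  (i + j == k + 2 * n./2 %[mod n])%N%:R.

Definition eta_coef (R : realType) (n : nat) (k l : 'I_n) : R[i] :=
  sqrtC n%:R * (l == k + n./2 %[mod n])%N%:R.

(* The tensor power of C[x]/(x^n - 1) over the circles of Gam: u K is the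
   coefficient of u on the monomial tensor (x)_c x^(K c). *)
Definition tpower (R : realType) (n : nat) (G : multigraph) (Gam : ribbon G) :=
  {ffun {ffun circle Gam -> 'I_n} -> (R[i])^o}.

(* Coefficient on K' of the image of the monomial K under the map induced by a
   half-twist at h, from the circles of Gam to those of Gam'. The affected
   circles are those through the sides of h; the others are the same sets of
   flags in Gam and Gam'. *)
Definition twist_coef (R : realType) (n : nat) (G : multigraph)
    (Gam Gam' : ribbon G) (h : half_edge G)
    (K : {ffun circle Gam -> 'I_n}) (K' : {ffun circle Gam' -> 'I_n}) : R[i] :=
  let a := circle_of Gam (inl h, false) in
  let b := circle_of Gam (inl h, true) in
  let a' := circle_of Gam' (inl h, false) in
  let b' := circle_of Gam' (inl h, true) in
  if [forall c : circle Gam, forall c' : circle Gam',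
        [&& val c == val c', c != a & c != b] ==> (K c == K' c')]
  then if a != b then mu_coef R (K a) (K b) (K' a')
       else if a' != b' then Delta_coef R (K a) (K' a') (K' b')
       else eta_coef R (K a) (K' a')
  else 0.

Definition twist_map (R : realType) (n : nat) (G : multigraph)
    (Gam Gam' : ribbon G) (h : half_edge G) (u : tpower R n Gam) :
    tpower R n Gam' :=
  [ffun K' => \sum_(K : {ffun circle Gam -> 'I_n})
                u K * twist_coef R h K K'].

(* Composition of the maps of the half-twists in p, a list of coordinates of
   alpha to be raised successively, the last one leading to alpha'. *)
Fixpoint path_map (R : realType) (n : nat) (G : multigraph) (Gam : ribbon G)
    (p : seq (half_edge G)) (alpha alpha' : hstate G) {struct p} :
    tpower R n (ins_twists Gam alpha) -> tpower R n (ins_twists Gam alpha') :=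
  match p with
  | [::] => fun _ => 0
  | [:: h] => fun u => twist_map (ins_twists Gam alpha') h u
  | h :: q => fun u =>
      path_map q alpha' (twist_map (ins_twists Gam (raise_to1 alpha h)) h u)
  end.

(* A choice, for each state and each vertex, of a path in the cube of
   half-edge states raising the half-edges at that vertex one at a time. *)
Definition path_choice (G : multigraph)
    (p : state G -> vert G -> seq (half_edge G)) : Prop :=
  forall (nu : state G) (v : vert G), perm_eq (p nu v) (enum (halves_at v)).

(* The filtered complex as the direct sum over all states, in the basis of all
   pairs of a state and a monomial on its circles. *)
Definition chain_index (n : nat) (G : multigraph) (Gam : ribbon G) : finType :=
  {nu : state G & {ffun circle (state_graph Gam nu) -> 'I_n}}.

Definition at_state (n : nat) (G : multigraph) (Gam : ribbon G) (nu : state G)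
    (K : {ffun circle (state_graph Gam nu) -> 'I_n}) : chain_index n Gam :=
  existT _ nu K.

Definition chain (R : realType) (n : nat) (G : multigraph) (Gam : ribbon G) :=
  {ffun chain_index n Gam -> (R[i])^o}.

Definition chain_proj (R : realType) (n : nat) (G : multigraph) (Gam : ribbon G)
    (nu : state G) (u : chain R n Gam) : tpower R n (state_graph Gam nu) :=
  [ffun K => u (at_state K)].

Definition chain_inj (R : realType) (n : nat) (G : multigraph) (Gam : ribbon G)
    (nu : state G) (w : tpower R n (state_graph Gam nu)) : chain R n Gam :=
  \sum_K w K *: [ffun x => (x == at_state K)%:R].

(* The vertices are ordered by [enum_rank]; as vert G is an arbitrary finType,
   this is an arbitrary total order. *)
Definition ones_before (G : multigraph) (nu : state G) (v : vert G) : nat :=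
  #|[set u : vert G | nu u && (enum_rank u < enum_rank v)%N]%SET|.

Definition differential (R : realType) (n : nat) (G : multigraph)
    (Gam : ribbon G) (p : state G -> vert G -> seq (half_edge G)) (u : chain R n Gam) :
    chain R n Gam :=
  \sum_(nu : state G) \sum_(v : vert G | ~~ nu v)
    (-1) ^+ ones_before nu v *:
      chain_inj (nu := raise_to1 nu v)
        (path_map (p nu v) (half_edge_state (raise_to1 nu v))
           (chain_proj nu u)).

Definition unity_root (R : realType) (n : nat) : R[i] :=
  Complex (cos (2 * pi / n%:R)) (sin (2 * pi / n%:R)).

Definition color_elt (R : realType) (n : nat) (i : 'I_n) :
    {ffun 'I_n -> R[i]} :=
  [ffun k : 'I_n => n%:R^-1 * unity_root R n ^+ (k * i)%N].

Definition color_basis (R : realType) (n : nat) (G : multigraph)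
    (Gam : ribbon G) (I : {ffun circle Gam -> 'I_n}) : tpower R n Gam :=
  [ffun K : {ffun circle Gam -> 'I_n} =>
     \prod_(c : circle Gam) color_elt R (I c) (K c)].

Definition chain_color (R : realType) (n : nat) (G : multigraph)
    (Gam : ribbon G) (x : chain_index n Gam) : chain R n Gam :=
  chain_inj (color_basis R (tagged x)).

Definition color_orthonormal (R : realType) (n : nat) (G : multigraph)
    (Gam : ribbon G) (dot : {dot (chain R n Gam) for Num.conj}) : Prop :=
  forall x y : chain_index n Gam,
    dot (chain_color R x) (chain_color R y) = (x == y)%:R.

Definition adjoint_for (R : realType) (n : nat) (G : multigraph)
    (Gam : ribbon G) (dot : {dot (chain R n Gam) for Num.conj})
    (f g : chain R n Gam -> chain R n Gam) : Prop :=
  forall u w : chain R n Gam, dot (f u) w = dot u (g w).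

Definition VCH (R : realType) (n : nat) (G : multigraph) (Gam : ribbon G)
    (d ds : chain R n Gam -> chain R n Gam) (nu : state G) :
    set (tpower R n (state_graph Gam nu)) :=
  [set w | d (chain_inj w) = 0 /\ ds (chain_inj w) = 0]%classic.

Definition harmonic_colorings (R : realType) (n : nat) (G : multigraph)
    (Gam : ribbon G) (d ds : chain R n Gam -> chain R n Gam) (nu : state G) :
    set (tpower R n (state_graph Gam nu)) :=
  (range (@color_basis R n G (state_graph Gam nu))
     `&` VCH d ds (nu := nu))%classic.

(* Each corner at v is counted at the left side of the half-edge before it. *)
Definition colors_at (n : nat) (G : multigraph) (Gam : ribbon G)
    (I : {ffun circle Gam -> 'I_n}) (v : vert G) : {set 'I_n} :=
  [set I (circle_of Gam (inl h, true)) | h in halves_at v]%SET.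

Definition proper_at (n : nat) (G : multigraph) (Gam : ribbon G)
    (I : {ffun circle Gam -> 'I_n}) (v : vert G) : bool :=
  (#|colors_at I v| == 3)%N.

Definition partial_at (n : nat) (G : multigraph) (Gam : ribbon G)
    (I : {ffun circle Gam -> 'I_n}) (v : vert G) : bool :=
  (#|colors_at I v| == 2)%N.

Definition partial_coloring (n : nat) (G : multigraph) (Gam : ribbon G)
    (I : {ffun circle Gam -> 'I_n}) : Prop :=
  forall v : vert G, proper_at I v || partial_at I v.

Definition edge_side (G : multigraph) (e : all_edge G) (s : bool) :
    side_flag G :=
  match e with
  | inl e => (inl (e, false), s)
  | inr o => (inr o, s)
  end.

Definition induced_matching (n : nat) (G : multigraph) (Gam : ribbon G)
    (I : {ffun circle Gam -> 'I_n}) : {set all_edge G} :=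
  [set e : all_edge G | I (circle_of Gam (edge_side e false))
                        == I (circle_of Gam (edge_side e true))]%SET.

(* Main.v *)
(** Write a coloring of the circles of a ribbon graph as a function on flags. In
  the color basis, mu, Delta and eta are diagonal: mu(c_i (x) c_j) is c_i or 0
  according to whether i = j, and Delta(c_i), eta(c_i) are nonzero multiples of
  c_i (x) c_i and c_i. Hence the half-twist at h kills c_I when the two sides of
  h have different colors, and otherwise sends it to a nonzero multiple of the
  basis element with the same colors on all flags. So the component of the
  differential at v kills c_I unless the three corners of v have the same color,
  and in that case its value is a nonzero multiple of a basis element; dually for
  the adjoint. As c_I is a basis element in every state graph in which its flag
  coloring makes sense, c_I is harmonic iff no vertex is monochromatic. *)

Require Import Defs.
From mathcomp Require Import all_boot all_order all_algebra all_fingroup.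
From mathcomp Require Import boolp classical_sets functions reals trigo.
From mathcomp Require Import complex ring.

Set Implicit Arguments.
Unset Strict Implicit.
Unset Printing Implicit Defensive.

Import Order.TTheory GRing.Theory Num.Theory.
Local Open Scope ring_scope.

(** * Colors in C[x]/(x^n - 1) *)

Lemma unity_root_expr (R : realType) (n k : nat) :
  unity_root R n ^+ k
  = Complex (cos (2 * pi / n%:R *+ k)) (sin (2 * pi / n%:R *+ k)).
Proof.
rewrite /unity_root; move: (2 * pi / _) => t.
elim: k => [|k IHk]; first by rewrite !mulr0n cos0 sin0.
by rewrite exprS IHk !mulrS cosD sinD; congr Complex; rewrite addrC.
Qed.

(** If the order m were smaller than n, then cos (2 pi m / n) = 1, so the double angle formula gives
    sin (pi m / n) = 0, although pi m / n lies strictly between 0 and pi. *)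
Lemma unity_root_prim (R : realType) (n : nat) :
  (0 < n)%N -> n.-primitive_root (unity_root R n).
Proof.
move=> n_gt0; have nR0 : n%:R != 0 :> R by rewrite pnatr_eq0 -lt0n.
have rootn : unity_root R n ^+ n = 1.
  rewrite unity_root_expr -[_ *+ n]mulr_natr divfK // mulrC mulr_natr.
  by rewrite -[_ *+ 2]add0r cosD2pi sinD2pi cos0 sin0.
have [m prim_m m_n] := prim_order_exists n_gt0 rootn.
suff n_m : n = m by rewrite {1}n_m.
have m_gt0 := prim_order_gt0 prim_m.
have [//|m_lt_n] := eqVneq n m; have {m_lt_n}m_lt_n : (m < n)%N.
  by rewrite ltn_neqAle eq_sym m_lt_n dvdn_leq.
have := prim_expr_order prim_m; rewrite unity_root_expr => -[cos1 _].
have : 0 < sin (pi / n%:R *+ m : R).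
  have n_pos : 0 < n%:R :> R by rewrite ltr0n.
  apply: sin_gt0_pi; rewrite -mulr_natr mulr_gt0 ?divr_gt0 ?pi_gt0 ?ltr0n //=.
  by rewrite mulrAC ltr_pdivrMr // ltr_pM2l ?pi_gt0 // ltr_nat.
move: cos1; have -> : 2 * pi / n%:R *+ m = (pi / n%:R *+ m) *+ 2 :> R.
  by rewrite -mulrA mulr_natl mulrnAC.
rewrite cos_mulr2n => cos1 sin_gt0.
have := cos2Dsin2 (pi / n%:R *+ m : R).
have -> : cos (pi / n%:R *+ m : R) ^+ 2 = 1.
  apply: (mulIf (_ : 2 != 0 :> R)); first by rewrite pnatr_eq0.
  by rewrite mulr_natr; move/(canRL (subrK _)): cos1 => ->; rewrite mul1r.
by move=> /(canRL (addKr _)); rewrite addNr => /eqP; rewrite sqrf_eq0 gt_eqF.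
Qed.

Lemma sum_eq_mod (R : pzSemiRingType) (n s t : nat) : (0 < n)%N ->
  \sum_(k < n) (s == k + t %[mod n])%N%:R = 1 :> R.
Proof.
(* [k0] represents s - t modulo n; reducing t first keeps the truncated subtraction exact. *)
move=> n_gt0; pose k0 := Ordinal (ltn_pmod (s + (n - t %% n)) n_gt0).
have k0P : (s == k0 + t %[mod n])%N.
  rewrite /= modnDml {2}(divn_eq t n) addnCA -addnA subnK; last exact/ltnW/ltn_pmod.
  by rewrite modnMDl modnDr.
rewrite (bigD1 k0) //= k0P big1 ?addr0 // => k; apply: contraNeq => kP.
have : (s == k + t %[mod n])%N by case: (s %% n == _)%N kP; rewrite // eqxx.
by rewrite (eqP k0P) eqn_modDr !modn_small // eq_sym.
Qed.

(** Spreads a closed form over the unique solution k of a congruence, so that it can be compared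
    term by term with a sum of structure constants. *)
Lemma mulr_sum_eq_mod (R : pzSemiRingType) (n s t : nat) (x : R) : (0 < n)%N ->
  x = \sum_(k < n) x * (s == k + t %[mod n])%N%:R.
Proof. by move=> n_gt0; rewrite -mulr_sumr sum_eq_mod // mulr1. Qed.

(** A geometric series whose ratio w is an n-th root of unity: for w different from 1, multiplying
    by w - 1 gives w^n - 1 = 0. *)
Lemma sum_prim_expr (R : realType) (n i j : nat) : (0 < n)%N ->
  \sum_(k < n) (unity_root R n ^+ i / unity_root R n ^+ j) ^+ k
  = n%:R * (i == j %[mod n])%N%:R.
Proof.
move=> n_gt0; set z := unity_root R n; have prim_z := unity_root_prim R n_gt0.
have z0 : z ^+ j != 0.
  by rewrite expf_neq0 // (prim_root_eq0 prim_z) -lt0n.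
rewrite -(eq_prim_root_expr prim_z) -/z.
case: (eqVneq (z ^+ i) (z ^+ j)) => [->|zij].
  rewrite divff // (eq_bigr (fun=> 1)) => [|k _]; last by rewrite expr1n.
  by rewrite sumr_const card_ord mulr1.
set w := _ / _; have w1 : w != 1.
  by rewrite -subr_eq0 /w -(inj_eq (mulIf z0)) mulrBl divfK // mul0r mul1r subr_eq0.
rewrite mulr0; apply/eqP; rewrite -(inj_eq (mulfI (_ : w - 1 != 0))) ?subr_eq0 //.
rewrite mulr0 -subrX1 subr_eq0 /w expr_div_n -!exprM mulnC [(j * n)%N]mulnC.
by rewrite !exprM (prim_expr_order prim_z) !expr1n divr1.
Qed.

Section Colors.
Variables (R : realType) (n : nat).
Hypothesis n_gt0 : (0 < n)%N.
Local Notation z := (unity_root R n).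

Let z_neq0 k : z ^+ k != 0.
Proof. by rewrite expf_neq0 // (prim_root_eq0 (unity_root_prim R n_gt0)) -lt0n. Qed.

Let nC_neq0 : n%:R != 0 :> R[i].
Proof. by rewrite pnatr_eq0 -lt0n. Qed.

Let expr_eq_mod (a b i : nat) : (a == b %[mod n])%N ->
  z ^+ (a * i) = z ^+ (b * i).
Proof.
move=> ab; apply/eqP; rewrite (eq_prim_root_expr (unity_root_prim R n_gt0)).
by rewrite -modnMml (eqP ab) modnMml.
Qed.

(** The congruence determines l from k. What remains is a geometric series in k, so orthogonality of
    characters separates distinct colors. *)
Lemma mu_color (i j s : 'I_n) :
  \sum_k \sum_l color_elt R i k * color_elt R j l * mu_coef R k l s
  = (i == j)%:R * color_elt R i s.
Proof.
transitivity (\sum_(k < n) n%:R^-1 * color_elt R j s * (z ^+ i / z ^+ j) ^+ k).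
  apply: eq_bigr => k _; rewrite [RHS](mulr_sum_eq_mod s k _ n_gt0).
  apply: eq_bigr => l _; rewrite /mu_coef addnC !ffunE.
  case sE: (_ == _)%N; last by rewrite !mulr0.
  rewrite !mulr1 (expr_eq_mod j sE) mulnDl exprD expr_div_n -!exprM.
  rewrite (mulnC i k) (mulnC j k).
  by field; rewrite z_neq0 nC_neq0.
rewrite -mulr_sumr sum_prim_expr // !modn_small ?ltn_ord // !ffunE val_eqE.
by case: eqP => [->|_]; rewrite ?mulr0 ?mul0r //=; field; exact: nC_neq0.
Qed.

(** For fixed a and b a single k contributes; the scalar comes from the shift by 2m and from one
    normalising factor 1/n less on the left. *)
Lemma Delta_color (i a b : 'I_n) :
  \sum_k color_elt R i k * Delta_coef R k a b
  = n%:R / z ^+ (2 * n./2 * i) * (color_elt R i a * color_elt R i b).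
Proof.
rewrite /Delta_coef; move: (2 * n./2)%N => t.
rewrite [RHS](mulr_sum_eq_mod (a + b) t _ n_gt0).
apply: eq_bigr => k _; rewrite !ffunE.
case sE: (_ == _)%N; last by rewrite !mulr0.
rewrite !mulr1; have := expr_eq_mod i sE; rewrite !mulnDl !exprD => zab.
have -> : z ^+ (k * i) = z ^+ (a * i) * z ^+ (b * i) / z ^+ (t * i).
  by rewrite zab mulfK.
by field; rewrite z_neq0 nC_neq0.
Qed.

Lemma eta_color (i l : 'I_n) :
  \sum_k color_elt R i k * eta_coef R k l
  = sqrtC n%:R / z ^+ (n./2 * i) * color_elt R i l.
Proof.
rewrite [RHS](mulr_sum_eq_mod l n./2 _ n_gt0).
apply: eq_bigr => k _; rewrite /eta_coef !ffunE.
case sE: (_ == _)%N; last by rewrite !mulr0.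
rewrite !mulr1 (expr_eq_mod i sE) mulnDl exprD.
by field; rewrite z_neq0 nC_neq0.
Qed.

Lemma Delta_scalar_neq0 (i : 'I_n) : n%:R / z ^+ (2 * n./2 * i) != 0 :> R[i].
Proof. by rewrite mulf_neq0 ?invr_eq0. Qed.

Lemma eta_scalar_neq0 (i : 'I_n) : sqrtC n%:R / z ^+ (n./2 * i) != 0 :> R[i].
Proof. by rewrite mulf_neq0 ?invr_eq0 ?sqrtC_eq0. Qed.

End Colors.

(** * Boundary circles and half-twists *)

Lemma even_card_involutive (T : finType) (i : T -> T) (C : {set T}) :
  involutive i -> (forall x, i x != x) -> (forall x, x \in C -> i x \in C) ->
  ~~ odd #|C|.
Proof.
move=> iK i_neq; have [n] := ubnP #|C|; elim: n C => // n IHn C leCn Ci.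
have [->|[x xC]] := set_0Vmem C; first by rewrite cards0.
have ixD : i x \in C :\ x by rewrite !inE i_neq Ci.
move: leCn; rewrite (cardsD1 x) xC (cardsD1 (i x)) ixD !add1n /= negbK => leCn.
apply: IHn => [|y]; first by rewrite -ltnS ltnW.
rewrite !inE => /and3P[y_ix y_x yC].
rewrite Ci // andbT (inj_eq (inv_inj iK)) y_x /=.
by rewrite -(inj_eq (inv_inj iK)) iK.
Qed.

(** Paths from x only visit points reachable from x, so agreement there suffices. It serves to
    recognise a circle that avoids a twisted band. *)
Lemma eq_connect_from (T : finType) (e e' : rel T) (x : T) :
  (forall y, connect e x y -> e y =1 e' y) -> connect e x =1 connect e' x.
Proof.
have eq_path p y : (forall z, connect e y z -> e z =1 e' z) ->
    path e y p = path e' y p.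
  elim: p y => //= z p IHp y ee'; rewrite -ee' ?connect0 //.
  have [yz|//] := boolP (e y z); apply: IHp => w zw; apply: ee'.
  exact: connect_trans (connect1 yz) zw.
move=> ee' y; apply/connectP/connectP => -[p]; rewrite ?eq_path // => ep ->.
- by exists p.
- by exists p; rewrite ?eq_path.
Qed.

Section Circles.
Variables (G : multigraph) (Gam : ribbon G).
Implicit Types (f g : side_flag G) (c : circle Gam).

Lemma bd_conn_sym : connect_sym (fun f g => bd_step Gam f g || bd_step Gam g f).
Proof. by apply: sym_connect_sym => f g; rewrite orbC. Qed.

Lemma circle_of_eq f g : bd_conn Gam f g -> circle_of Gam f = circle_of Gam g.
Proof.
move=> fg; apply: val_inj; apply/setP => k.
by rewrite !inE /bd_conn (same_connect bd_conn_sym fg).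
Qed.

Lemma circle_of_val c f : f \in val c -> circle_of Gam f = c.
Proof.
case: c => B Bc /= fB; apply: val_inj => /=; case/imsetP: Bc fB => g _ ->.
by rewrite inE => /circle_of_eq/(congr1 val).
Qed.

Lemma mem_circle_of f : f \in val (circle_of Gam f).
Proof. by rewrite inE /bd_conn connect0. Qed.

Lemma circle_ofP c : {f | circle_of Gam f = c}.
Proof.
have [f fc|c0] := pickP (mem (val c)); first by exists f; apply: circle_of_val.
exfalso; case/imsetP: (valP c) => f _ cE; have := c0 f.
by rewrite -[mem _ _]/(f \in val c) cE inE /bd_conn connect0.
Qed.

Lemma circle_of_eqE f g :
  (circle_of Gam f == circle_of Gam g) = bd_conn Gam f g.
Proof.
apply/eqP/idP=> [/(congr1 val)/= fg|]; last exact: circle_of_eq.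
by have := mem_circle_of g; rewrite /= -fg inE.
Qed.

(** Colorings of circles are built on flags, because the flags, unlike the circles, are common to
    all states. *)
Lemma flag_coloring_lift (X : finType) (phi : side_flag G -> X) :
  (forall f g, bd_step Gam f g -> phi f = phi g) ->
  {I : {ffun circle Gam -> X} | forall f, I (circle_of Gam f) = phi f}.
Proof.
move=> phiP; exists [ffun c => phi (sval (circle_ofP c))] => f; rewrite ffunE.
case: circle_ofP => g /= /eqP; rewrite circle_of_eqE => /connectP[p].
elim: p g => [|k p IHp] g /=; first by move=> _ ->.
by move=> /andP[/orP[] /phiP] => [->|<-]; apply: IHp.
Qed.

End Circles.

(** * The effect of one half-twist on the boundary circles *)

Definition twist_at (G : multigraph) (Gam Gam' : ribbon G) (h : half_edge G) :=
  Defs.rot Gam' = Defs.rot Gam /\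
  forall e, twisted Gam' e = twisted Gam e (+) (e == inl h.1).

Lemma twist_at_sym (G : multigraph) (Gam Gam' : ribbon G) (h : half_edge G) :
  twist_at Gam Gam' h -> twist_at Gam' Gam h.
Proof. by case=> rotE twE; split=> [|e]; rewrite ?rotE ?twE ?addbK. Qed.

Definition on_edge (G : multigraph) (e : edge G) (f : side_flag G) : bool :=
  if f.1 is inl h then h.1 == e else false.

Lemma other_halfK (G : multigraph) : involutive (@other_half G).
Proof. by case=> e b; rewrite /other_half /= negbK. Qed.

Lemma bd_conn_band (G : multigraph) (Gam : ribbon G) (h : half_edge G) s :
  bd_conn Gam (inl h, s) (inl (other_half h), s (+) ~~ twisted Gam (inl h.1)).
Proof. by apply: connect1; rewrite /= !eqxx orbT. Qed.

Lemma bd_conn_corner (G : multigraph) (Gam : ribbon G) (h : half_edge G) :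
  bd_conn Gam (inl h, true) (inl (Defs.rot Gam h), false).
Proof. by apply: connect1; rewrite /= !eqxx. Qed.

Lemma half_edge_cases (G : multigraph) (h k : half_edge G) :
  k.1 = h.1 -> k = h \/ k = other_half h.
Proof.
case: h k => e b [e' b'] /= ->; rewrite /other_half /=.
by case: b b' => -[]; auto.
Qed.

(** The four flags of a band are paired along the band, so the two sides of h already meet every
    circle that runs through it. *)
Lemma on_edge_circle (G : multigraph) (Gam : ribbon G) (h : half_edge G) f :
  on_edge h.1 f ->
  exists s, circle_of Gam f = circle_of Gam (inl h, s).
Proof.
case: f => -[k s|//]; rewrite /on_edge /= => /eqP/half_edge_cases[->|->].
  by exists s.
exists (s (+) ~~ twisted Gam (inl h.1)); apply: circle_of_eq.
by have := bd_conn_band Gam (other_half h) s; rewrite other_halfK.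
Qed.

(** Changing the twist of a band only changes how its four flags are joined. When both sides have
    the same color, all four flags share it, and either way of joining respects the coloring. *)
Lemma coloring_transfer (G : multigraph) (Gam Gam' : ribbon G) (X : finType)
    (I : {ffun circle Gam -> X}) :
  Defs.rot Gam' = Defs.rot Gam ->
  (forall e : all_edge G, twisted Gam' e != twisted Gam e ->
     I (circle_of Gam (edge_side e false)) = I (circle_of Gam (edge_side e true))) ->
  {I' : {ffun circle Gam' -> X} |
    forall f, I' (circle_of Gam' f) = I (circle_of Gam f)}.
Proof.
move=> rotE Ie; apply: flag_coloring_lift.
have circ f g : bd_step Gam f g -> I (circle_of Gam f) = I (circle_of Gam g).
  by move=> fg; congr (I _); apply/circle_of_eq/connect1; rewrite /= fg.
move=> [[h|o] s] [[h'|o'] s'] //=; last first.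
  case/and3P=> /eqP-> /eqP-> tw'; have [tw|tw] := boolP (twisted Gam (inr o)).
    by apply: circ; rewrite /= !eqxx.
  by have := Ie (inr o); rewrite tw' (negbTE tw) => /(_ isT); case: s => /= ->.
case/orP=> [|/andP[/eqP-> /eqP->]].
  by rewrite rotE => fg; apply: circ; rewrite /= fg.
have [tw|tw] := eqVneq (twisted Gam' (inl h.1)) (twisted Gam (inl h.1)).
  by apply: circ; rewrite /= tw !eqxx orbT.
(* In a band whose twist differs, every flag lies on one of the two circles along the sides, and
   these have equal colors. *)
have I_on f : on_edge h.1 f ->
    I (circle_of Gam f) = I (circle_of Gam (inl (h.1, false), true)).
  by case/(@on_edge_circle G Gam (h.1, false)) => -[] ->; rewrite ?(Ie _ tw).
by rewrite !I_on /on_edge /=.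
Qed.

Section OneTwist.
Variables (G : multigraph) (Gam Gam' : ribbon G) (h : half_edge G).
Hypothesis tw : twist_at Gam Gam' h.

Let step_eq f g : ~~ on_edge h.1 f ->
  (bd_step Gam f g || bd_step Gam g f) = (bd_step Gam' f g || bd_step Gam' g f).
Proof.
case: tw => rotE twE; case: f g => -[k|o] s [[l|o'] t]; rewrite /on_edge /=.
- rewrite rotE !twE /= => k_h; have -> : (inl k.1 == inl h.1 :> all_edge G) = false.
    by rewrite -(negbTE k_h).
  rewrite !addbF; have [lk|] := boolP (k == other_half l).
    have -> : (inl l.1 == inl h.1 :> all_edge G) = false.
      by rewrite -(negbTE k_h) (eqP lk).
    by rewrite addbF.
  by rewrite !andFb.
- by [].
- by [].
- by move=> _; rewrite !twE /= !addbF.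
Qed.

(** A circle through neither side of h avoids the whole band, and away from the band the boundary
    steps of both ribbon graphs agree. The reverse inclusion follows by symmetry of [twist_at]. *)
Lemma circles_off_twist :
  circles Gam :\ bd_class Gam (inl h, false) :\ bd_class Gam (inl h, true)
  \subset
  circles Gam' :\ bd_class Gam' (inl h, false) :\ bd_class Gam' (inl h, true).
Proof.
apply/fintype.subsetP => X; rewrite !inE => /and3P[X1 X0 /imsetP[f _ XE]].
have off g : bd_conn Gam f g -> ~~ on_edge h.1 g.
  move=> fg; apply/negP => /(@on_edge_circle G Gam)[s].
  rewrite -(circle_of_eq fg) => /(congr1 val) /=; rewrite -XE => XhE.
  by case: s XhE => XhE; rewrite XhE eqxx in X0 X1.
have XE' : X = bd_class Gam' f.
  rewrite XE; apply/setP => g; rewrite !inE; apply: eq_connect_from => k fk l.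
  exact/step_eq/off.
have offX s : (inl h, s) \notin X.
  by rewrite XE inE; apply: contraL isT => /off; rewrite /on_edge /= eqxx.
apply/and3P; split; last by rewrite XE' imset_f.
- by apply: contraNneq (offX true) => ->; rewrite (mem_circle_of Gam').
- by apply: contraNneq (offX false) => ->; rewrite (mem_circle_of Gam').
Qed.

(* After removal of the band at h, the circle through (h, false) becomes a path
   whose only flags of the band are its two ends; its other end is found by a
   parity count of flags, paired by corners and by the remaining bands. *)
Lemma twist_merges : ~~ bd_conn Gam (inl h, false) (inl h, true) ->
  bd_conn Gam' (inl h, false) (inl h, true).
Proof.
case: (tw) => rotE twE nconn.
pose F : finType := (half_edge G * bool)%type.
(* [cp] exchanges the two flags of a corner and [bp] the two ends of a side of a band; [r] walks
   along the boundary with the band of h removed. *)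
pose cp (x : F) : F :=
  if x.2 then (Defs.rot Gam x.1, false) else ((Defs.rot Gam)^-1%g x.1, true).
pose bp (x : F) : F := (other_half x.1, x.2 (+) ~~ twisted Gam (inl x.1.1)).
have cpK : involutive cp by case=> k [] /=; rewrite /cp /= ?permK ?permKV.
have bpK : involutive bp by case=> k s; rewrite /bp /= other_halfK addbK.
pose r (x y : F) := (y == cp x) || (x.1.1 != h.1) && (y == bp x).
pose flag (x : F) : side_flag G := (inl x.1, x.2).
(* Walks of [r] never cross the band of h, so they are boundary walks in [Gam] and in [Gam']
   alike. *)
have r_conn (Del : ribbon G) x y : Defs.rot Del = Defs.rot Gam ->
    (forall e, inl h.1 != e -> twisted Del e = twisted Gam e) ->
    connect r x y -> bd_conn Del (flag x) (flag y).
  move=> rotD twD /connectP[q].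
  elim: q x => [x _ ->|z q IHq x /=]; first exact: connect0.
    case/andP=> xz /IHq{}IHq /IHq; apply: connect_trans.
    case/orP: xz => [/eqP->|].
      case: x => k []; rewrite /cp /flag /= -rotD; first exact: bd_conn_corner.
      have := bd_conn_corner Del ((Defs.rot Del)^-1%g k).
      by rewrite permKV => /circle_of_eq/esym/eqP; rewrite circle_of_eqE.
    case/andP=> x_h /eqP->; rewrite /bp /flag /= -twD; first exact: bd_conn_band.
    by rewrite eq_sym; apply: contraNneq x_h => -[->].
(* [cp] pairs the flags of [C], and [bp] those of [C] off the band, so an even number of flags of
   [C] lies on the band: besides (h, false) there is another one. *)
pose C := [set y | connect r (h, false) y].
pose E := [set y : F | y.1.1 == h.1].
have evC : ~~ odd #|C|.
  apply: (even_card_involutive cpK) => [[k []]|x]; rewrite ?xpair_eqE ?andbF //.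
  rewrite !inE => hx.
  by apply: connect_trans hx (connect1 _); rewrite /r eqxx.
have evCE : ~~ odd #|C :\: E|.
  apply: (even_card_involutive bpK) => [[[e []] s]|x].
  - by rewrite !xpair_eqE andbF.
  - by rewrite !xpair_eqE andbF.
  rewrite !inE => /andP[xE hx]; rewrite xE /=.
  by apply: connect_trans hx (connect1 _); rewrite /r xE eqxx orbT.
have hCE : (h, false) \in C :&: E by rewrite !inE /= eqxx connect0.
have [y] : exists y, y \in (C :&: E) :\ (h, false).
  apply/finset.set0Pn; apply: contraNneq evCE => CE0.
  rewrite cardsD oddB ?subset_leq_card ?subsetIl //.
  by rewrite (cardsD1 (h, false) (C :&: E)) hCE CE0 cards0 addbT.
rewrite !inE => /and3P[y_h hy /eqP/half_edge_cases yE].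
have yGam : bd_conn Gam (inl h, false) (flag y) by apply: r_conn hy.
have yGam' : bd_conn Gam' (inl h, false) (flag y).
  by apply: r_conn hy => // e e_h; rewrite twE eq_sym (negbTE e_h) addbF.
case: y y_h {hy} yE yGam yGam' => k s + /= kE; rewrite /flag /=.
case: kE => ->; first by case: s => [_ conn|]; [rewrite conn in nconn | rewrite eqxx].
move=> _ hy hy'.
(* The walk ends at the far end of the band, from which the band leads to opposite sides of h in
   [Gam] and [Gam']. By assumption it is not the left side in [Gam], so it is in [Gam']. *)
have := bd_conn_band Gam (other_half h) s.
have := bd_conn_band Gam' (other_half h) s.
rewrite !other_halfK /= twE eqxx => step' step.
have := connect_trans hy step; have := connect_trans hy' step'.
rewrite addbT negbK.
by case: (twisted _ _) s {hy hy' step step'} => -[] //= _ conn;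
  rewrite /bd_conn conn in nconn.
Qed.

End OneTwist.

Lemma circles_off_twist_eq (G : multigraph) (Gam Gam' : ribbon G) h :
  twist_at Gam Gam' h ->
  circles Gam :\ bd_class Gam (inl h, false) :\ bd_class Gam (inl h, true)
  = circles Gam' :\ bd_class Gam' (inl h, false) :\ bd_class Gam' (inl h, true).
Proof.
move=> tw; apply/eqP; rewrite finset.eqEsubset circles_off_twist //.
exact/circles_off_twist/twist_at_sym.
Qed.

(** * A half-twist on the color basis *)

Lemma prodr_bool (R : comPzSemiRingType) (T : finType) (P B : pred T) :
  \prod_(c | P c) (B c)%:R = [forall c, P c ==> B c]%:R :> R.
Proof.
have [/forallP PB|] := boolP [forall c, P c ==> B c].
  by rewrite big1 // => c Pc; have /implyP-> := PB c.
case/forallPn => c; rewrite negb_imply => /andP[Pc /negbTE Bc].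
by rewrite (bigD1 c) //= Bc mul0r.
Qed.

Lemma prod_two (R : comPzSemiRingType) (C : finType) (a b : C) (H : C -> R) :
  \prod_c H c = (if a != b then H a * H b else H a)
                * \prod_(c | (c != a) && (c != b)) H c.
Proof.
rewrite (bigD1 a) //=; case: eqVneq => [<-|ab].
  by congr (_ * _); apply: eq_bigl => c; rewrite andbb.
by rewrite (bigD1 b) 1?eq_sym //= mulrA.
Qed.

(** F couples two coordinates, so distributivity does not apply at once. Summing over the value i of
    K a, enforced by an indicator in coordinate a, turns each summand into a product over C. *)
Lemma sum_ffun_two (R : comPzSemiRingType) (C J : finType) (a b : C)
    (F : J -> J -> R) (H : C -> J -> R) : a != b ->
  \sum_(K : {ffun C -> J})
     F (K a) (K b) * \prod_(c | (c != a) && (c != b)) H c (K c)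
  = (\sum_i \sum_j F i j) * \prod_(c | (c != a) && (c != b)) \sum_k H c k.
Proof.
move=> ab; rewrite mulr_suml.
pose H' i c k := if c == a then (k == i)%:R else if c == b then F i k else H c k.
transitivity (\sum_i \sum_(K : {ffun C -> J}) \prod_c H' i c (K c)).
  rewrite exchange_big /=; apply: eq_bigr => K _.
  rewrite [RHS](bigD1 (K a)) //= [X in _ = _ + X]big1 ?addr0 => [|i i_Ka]; last first.
    by rewrite (bigD1 a) //= /H' eqxx eq_sym (negbTE i_Ka) mul0r.
  rewrite (prod_two a b) ab /H' !eqxx eq_sym (negbTE ab) mul1r; congr (_ * _).
  by apply: eq_bigr => c /andP[/negbTE-> /negbTE->].
apply: eq_bigr => i _; rewrite -(bigA_distr_bigA (H' i)) (prod_two a b) ab /=.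
congr (_ * _); last first.
  by apply: eq_bigr => c /andP[/negbTE ca /negbTE cb]; rewrite /H' ca cb.
rewrite /H' !eqxx eq_sym (negbTE ab) (bigD1 i) //= eqxx big1 ?addr0 ?mul1r // => k.
by move/negbTE->.
Qed.

(** The repeated condition is the shape taken by the two-circle condition when both sides of h lie
    on one circle. *)
Lemma sum_ffun_one (R : comPzSemiRingType) (C J : finType) (a : C)
    (F : J -> R) (H : C -> J -> R) :
  \sum_(K : {ffun C -> J})
     F (K a) * \prod_(c | (c != a) && (c != a)) H c (K c)
  = (\sum_i F i) * \prod_(c | (c != a) && (c != a)) \sum_k H c k.
Proof.
pose H' c k := if c == a then F k else H c k.
transitivity (\sum_(K : {ffun C -> J}) \prod_c H' c (K c)).
  apply: eq_bigr => K _; rewrite (prod_two a a) /H' eqxx /=; congr (_ * _).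
  by apply: eq_bigr => c /andP[/negbTE->].
rewrite -bigA_distr_bigA (prod_two a a) /H' eqxx /=; congr (_ * _).
by apply: eq_bigr => c /andP[/negbTE->].
Qed.

Section TwistMap.
Variables (R : realType) (n : nat).
Hypothesis n_gt0 : (0 < n)%N.
Variables (G : multigraph) (Gam Gam' : ribbon G) (h : half_edge G).
Hypothesis tw : twist_at Gam Gam' h.
Variable I : {ffun circle Gam -> 'I_n}.

Let a := circle_of Gam (inl h, false).
Let b := circle_of Gam (inl h, true).
Let a' := circle_of Gam' (inl h, false).
Let b' := circle_of Gam' (inl h, true).

(** The contribution of an unaffected circle, indexed by its set of flags because that set is a
    circle of both ribbon graphs; 1 is a default for the empty set. *)
Let psi (K' : {ffun circle Gam' -> 'I_n}) (X : {set side_flag G}) : R[i] :=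
  if [pick f in X] is Some f
  then color_elt R (I (circle_of Gam f)) (K' (circle_of Gam' f)) else 1.

Let psi_off (K' : {ffun circle Gam' -> 'I_n}) :
  \prod_(c : circle Gam | (c != a) && (c != b)) psi K' (val c)
  = \prod_(c' : circle Gam' | (c' != a') && (c' != b')) psi K' (val c').
Proof.
have psiE (Del : ribbon G) :
    \prod_(c : circle Del | (c != circle_of Del (inl h, false))
                            && (c != circle_of Del (inl h, true))) psi K' (val c)
    = \prod_(X in circles Del :\ bd_class Del (inl h, false)
                              :\ bd_class Del (inl h, true)) psi K' X.
  pose P X := (X != bd_class Del (inl h, false)) && (X != bd_class Del (inl h, true)).
  rewrite -(big_sub_cond (mem (circles Del)) P).
  by apply: eq_bigl => X; rewrite !inE andbC andbA [_ && (_ != _)]andbC.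
by rewrite !psiE (circles_off_twist_eq tw).
Qed.

(** An unaffected circle of [Gam] is also exactly one circle of [Gam'], so the constraint selects a
    single exponent k. *)
Let sum_off (K' : {ffun circle Gam' -> 'I_n}) (c : circle Gam) : (c != a) && (c != b) ->
  \sum_k color_elt R (I c) k * [forall c', (val c == val c') ==> (k == K' c')]%:R
  = psi K' (val c).
Proof.
move=> ca; have [f fc] : {f | f \in val c}.
  by case: (circle_ofP c) => f <-; exists f; apply: mem_circle_of.
have cE : val c = bd_class Gam' f.
  have : val c \in circles Gam' :\ bd_class Gam' (inl h, false)
                                :\ bd_class Gam' (inl h, true).
    by rewrite -(circles_off_twist_eq tw) !inE (valP c) andbT andbC.
  rewrite !inE => /and3P[_ _ /imsetP[g _ cg]].
  by move: fc; rewrite cg inE => /circle_of_eq/(congr1 val).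
have onlyf k : [forall c', (val c == val c') ==> (k == K' c')]
               = (k == K' (circle_of Gam' f)).
  apply/forallP/idP => [/(_ (circle_of Gam' f))|/eqP-> c'].
    by rewrite cE eqxx.
  apply/implyP => /eqP cc'; have : f \in val c' by rewrite -cc'.
  by move/circle_of_val->.
rewrite (bigD1 (K' (circle_of Gam' f))) //= onlyf eqxx mulr1 big1 ?addr0; last first.
  by move=> k /negbTE kK; rewrite onlyf kK mulr0.
rewrite /psi; case: pickP => [g gc|/(_ f)]; last by rewrite fc.
rewrite (circle_of_val gc); congr (color_elt _ _ (K' _)).
by move: gc; rewrite cE inE => /circle_of_eq.
Qed.

Let T (K' : {ffun circle Gam' -> 'I_n}) (k l : 'I_n) : R[i] :=
  if a != b then mu_coef R k l (K' a')
  else if a' != b' then Delta_coef R k (K' a') (K' b')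
  else eta_coef R k (K' a').

(** The compatibility condition in [twist_coef] is a product of indicators over the unaffected
    circles, which separates the affected circles from the rest. *)
Let summandE (K : {ffun circle Gam -> 'I_n}) (K' : {ffun circle Gam' -> 'I_n}) :
  color_basis R I K * twist_coef R h K K'
  = (if a != b then color_elt R (I a) (K a) * color_elt R (I b) (K b)
     else color_elt R (I a) (K a)) * T K' (K a) (K b)
    * \prod_(c | (c != a) && (c != b))
        (color_elt R (I c) (K c)
         * [forall c', (val c == val c') ==> (K c == K' c')]%:R).
Proof.
rewrite /color_basis ffunE (prod_two a b) big_split /= prodr_bool.
have -> : [forall c, (c != a) && (c != b) ==>
             [forall c' : circle Gam', (val c == val c') ==> (K c == K' c')]]
   = [forall c : circle Gam, forall c' : circle Gam',
        [&& val c == val c', c != a & c != b] ==> (K c == K' c')].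
  apply: eq_forallb => c; case: (_ && _) => /=.
    by apply: eq_forallb => c'; rewrite andbT.
  by apply/esym/forallP => c'; rewrite andbF.
rewrite /twist_coef -/a -/b -/a' -/b' -/(T K' (K a) (K b)).
by case: [forall c, _]; rewrite /= ?mulr0 // mulr1 mulrAC.
Qed.

Let twist_mapE (K' : {ffun circle Gam' -> 'I_n}) :
  twist_map Gam' h (color_basis R I) K'
  = (if a != b
     then (I a == I b)%:R * color_elt R (I a) (K' a')
     else if a' != b'
     then n%:R / unity_root R n ^+ (2 * n./2 * I a)
          * (color_elt R (I a) (K' a') * color_elt R (I a) (K' b'))
     else sqrtC n%:R / unity_root R n ^+ (n./2 * I a) * color_elt R (I a) (K' a'))
    * \prod_(c' | (c' != a') && (c' != b')) psi K' (val c').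
Proof.
rewrite -psi_off /twist_map ffunE -(eq_bigr _ (@sum_off K')).
apply: etrans (eq_bigr _ (fun K _ => summandE K K')) _; rewrite /T.
have [ab|ab] := eqVneq a b; last first.
  rewrite (sum_ffun_two (fun k l => color_elt R (I a) k * color_elt R (I b) l
    * mu_coef R k l (K' a')) (fun c k => color_elt R (I c) k
    * [forall c', (val c == val c') ==> (k == K' c')]%:R) ab).
  by rewrite mu_color.
case: eqVneq => [a'b'|a'b'] /=.
- rewrite -ab (sum_ffun_one a (fun k => color_elt R (I a) k
    * eta_coef R k (K' a')) (fun c k => color_elt R (I c) k
    * [forall c', (val c == val c') ==> (k == K' c')]%:R)).
  by rewrite eta_color.
- rewrite -ab (sum_ffun_one a (fun k => color_elt R (I a) k
    * Delta_coef R k (K' a') (K' b')) (fun c k => color_elt R (I c) k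
    * [forall c', (val c == val c') ==> (k == K' c')]%:R)).
  by rewrite Delta_color.
Qed.

(** Different colors force two different circles, so the map is a merge, and mu annihilates products
    of distinct colors. *)
Lemma twist_map_color0 :
  I a != I b -> twist_map Gam' h (color_basis R I) = 0.
Proof.
move=> Iab; apply/ffunP => K'; rewrite twist_mapE [RHS]ffunE.
have -> : a != b by apply: contraNneq Iab => ->.
by rewrite (negbTE Iab) !mul0r.
Qed.

(** The scalar is 1 for a merge and the nonzero factor of Delta or eta otherwise. The existence of
    I' already forces equal colors on the two sides in a merge. *)
Lemma twist_map_color (I' : {ffun circle Gam' -> 'I_n}) :
  (forall f, I' (circle_of Gam' f) = I (circle_of Gam f)) ->
  exists2 k : R[i], k != 0 &
    twist_map Gam' h (color_basis R I) = k *: color_basis R I'.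
Proof.
move=> II'; pose k : R[i] := if a != b then 1 else if a' != b'
  then n%:R / unity_root R n ^+ (2 * n./2 * I a)
  else sqrtC n%:R / unity_root R n ^+ (n./2 * I a).
exists k.
  rewrite /k; case: ifP => _; first exact: oner_neq0.
  by case: ifP => _; rewrite ?Delta_scalar_neq0 ?eta_scalar_neq0.
apply/ffunP => K'; rewrite twist_mapE [RHS]ffunE /= [X in _ = k *: X]ffunE.
rewrite (prod_two a' b') [RHS]mulrA; congr (_ * _); last first.
  apply: eq_bigr => c' _; rewrite /psi; case: pickP => [f fc|c0].
    by rewrite -II' (circle_of_val fc).
  by case: (circle_ofP c') => f cE; have := c0 f; rewrite -cE mem_circle_of.
rewrite /k -[I a]II' -[I b]II' -/a' -/b'.
have [ab|ab] := eqVneq a b => /=.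
  case: eqVneq => [//|a'b' /=].
  by have -> : I' b' = I' a' by rewrite /a' /b' !II' -/a -/b ab.
(* After a merge both sides of h lie on one circle, so the target has a single affected factor. *)
have -> : a' = b'.
  by apply/eqP; rewrite circle_of_eqE; apply: twist_merges tw _; rewrite -circle_of_eqE.
by rewrite !eqxx.
Qed.

End TwistMap.

(** * The vertex maps *)

Lemma ins_twists_raise (G : multigraph) (Gam : ribbon G) (alpha : hstate G) h :
  ~~ alpha h ->
  twist_at (ins_twists Gam alpha) (ins_twists Gam (raise_to1 alpha h)) h.
Proof.
move=> ah; split=> // -[e|o] /=; last by rewrite addbF.
rewrite !ffunE; case: h ah => e' b /negbTE ah; rewrite !xpair_eqE /=.
rewrite -[inl e == _]/(e == e') -addbA; congr (_ (+) _).
case: (eqVneq e e') => [->|_]; last by rewrite addbF.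
by case: b ah => /= ->; rewrite ?addbF ?addbT ?addFb.
Qed.

Definition mono_side (G : multigraph) (X : finType) (Gam : ribbon G)
    (I : {ffun circle Gam -> X}) (h : half_edge G) : bool :=
  I (circle_of Gam (inl h, false)) == I (circle_of Gam (inl h, true)).

(** Seen from the other end, a band keeps or exchanges its two sides, and equality of their colors
    is symmetric; being monochromatic is thus a property of the edge. *)
Lemma mono_side_other (G : multigraph) (X : finType) (Gam : ribbon G)
    (I : {ffun circle Gam -> X}) (h : half_edge G) :
  mono_side I (other_half h) = mono_side I h.
Proof.
have band s : circle_of Gam (inl (other_half h), s (+) ~~ twisted Gam (inl h.1))
              = circle_of Gam (inl h, s).
  exact/esym/circle_of_eq/bd_conn_band.
rewrite /mono_side -[circle_of Gam (inl h, false)]band.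
rewrite -[circle_of Gam (inl h, true)]band.
by case: (twisted _ _) => //=; rewrite eq_sym.
Qed.

Lemma mono_side_edge (G : multigraph) (X : finType) (Gam : ribbon G)
    (I : {ffun circle Gam -> X}) (e : edge G) (b : bool) :
  mono_side I (e, b) = mono_side I (e, false).
Proof. by case: b; rewrite // -mono_side_other. Qed.

(** Phrased through the sides of half-edges rather than corners, since this is what the successive
    half-twists at v test. *)
Definition mono_at (G : multigraph) (X : finType) (Gam : ribbon G)
    (I : {ffun circle Gam -> X}) (v : vert G) : bool :=
  [forall h, (h \in halves_at v) ==> mono_side I h].

Section Paths.
Variables (R : realType) (n : nat).
Hypothesis n_gt0 : (0 < n)%N.
Variables (G : multigraph) (Gam : ribbon G).

Lemma twist_mapZ (Gam1 Gam2 : ribbon G) h (k : R[i]) (u : tpower R n Gam1) :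
  twist_map Gam2 h (k *: u) = k *: twist_map Gam2 h u.
Proof.
apply/ffunP => K; rewrite !ffunE scaler_sumr; apply: eq_bigr => K1 _.
by rewrite !ffunE -scalerAl.
Qed.

Lemma path_mapZ q (alpha alpha' : hstate G) (k : R[i])
    (u : tpower R n (ins_twists Gam alpha)) :
  Defs.path_map q alpha' (k *: u) = k *: Defs.path_map q alpha' u.
Proof.
elim: q alpha u => [|h q IHq] alpha u /=; first by rewrite scaler0.
by case: q IHq => [|h' q] IHq; rewrite twist_mapZ ?IHq.
Qed.

Lemma path_map0 q (alpha alpha' : hstate G) :
  Defs.path_map q alpha' (0 : tpower R n (ins_twists Gam alpha)) = 0.
Proof.
by rewrite -(scale0r (0 : tpower R n (ins_twists Gam alpha))) path_mapZ scale0r.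
Qed.

(** Each twist either kills the element or preserves the colors of all flags, so the remaining tests
    can be read off the initial coloring. The path must be nonempty because [path_map] is 0 by
    default on the empty list. *)
Lemma path_map_color q (alpha alpha' : hstate G)
    (I : {ffun circle (ins_twists Gam alpha) -> 'I_n}) :
  q != [::] -> uniq q -> (forall h, h \in q -> ~~ alpha h) ->
  (forall h, alpha' h = (h \in q) || alpha h) ->
  if all (mono_side I) q then
    exists k : R[i], exists I' : {ffun circle (ins_twists Gam alpha') -> 'I_n},
      [/\ k != 0, forall f, I' (circle_of _ f) = I (circle_of _ f)
        & Defs.path_map q alpha' (color_basis R I) = k *: color_basis R I']
  else Defs.path_map q alpha' (color_basis R I) = 0.
Proof.
elim: q alpha I => [//|h q IHq] alpha I _ /= /andP[hq q_uniq] a0 a'E.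
have tw := ins_twists_raise Gam (a0 h (mem_head h q)).
(* The target is left up to an equation: the last twist lands in the state of [alpha'], the earlier
   ones in the state raised at h. *)
have step_eq (D : ribbon G) : D = ins_twists Gam (raise_to1 alpha h) ->
  if mono_side I h then
    exists k : R[i], exists I' : {ffun circle D -> 'I_n},
      [/\ k != 0, forall f, I' (circle_of _ f) = I (circle_of _ f)
        & twist_map D h (color_basis R I) = k *: color_basis R I']
  else twist_map D h (color_basis R I) = 0.
  move=> {D}->; case: ifP => [Ih|/negbT Ih]; last first.
    exact: (twist_map_color0 R n_gt0 tw Ih).
  have [|e|I' II'] := @coloring_transfer G _ (ins_twists Gam (raise_to1 alpha h)) _ I.
  - by [].
  - rewrite (proj2 tw e); case: (e =P inl h.1) => [->|]; last by rewrite addbF eqxx.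
    by move=> _; apply/eqP; move: Ih; case: (h) => e' b; rewrite mono_side_edge.
  by have [k k0 kE] := twist_map_color R n_gt0 tw II'; exists k, I'.
case: q IHq hq q_uniq a0 a'E => [_ _ _ _ a'E|h' q IHq hq q_uniq a0 a'E].
  rewrite andbT; apply: step_eq; congr ins_twists.
  by apply/ffunP => k; rewrite ffunE a'E inE.
have := step_eq _ erefl; case: ifP => [Ih [k [I' [k0 II' ->]]]|_ ->]; last first.
  by rewrite path_map0.
have mono_eq : all (mono_side I) (h' :: q) = all (mono_side I') (h' :: q).
  by apply: eq_all => g; rewrite /mono_side !II'.
rewrite path_mapZ [true && _]/= -[_ && all _ _]/(all (mono_side I) (h' :: q)) mono_eq.
have raise0 g : g \in h' :: q -> ~~ raise_to1 alpha h g.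
  move=> gq; rewrite ffunE negb_or a0 1?inE ?gq ?orbT // andbT.
  by apply: contraNneq hq => <-.
have raiseE g : alpha' g = (g \in h' :: q) || raise_to1 alpha h g.
  by rewrite a'E ffunE in_cons orbCA orbA.
have := IHq (raise_to1 alpha h) I' isT q_uniq raise0 raiseE; case: ifP => mono.
  case=> k' [I'' [k'0 I'I'' ->]]; exists (k * k'), I''; split=> [|f|].
  - exact: mulf_neq0.
  - by rewrite I'I'' II'.
  - by rewrite scalerA.
by move=> ->; rewrite scaler0.
Qed.

Lemma vertex_map_color (nu : state G) (v : vert G) (q : seq (half_edge G))
    (I : {ffun circle (state_graph Gam nu) -> 'I_n}) :
  halves_at v != finset.set0 -> perm_eq q (enum (halves_at v)) -> ~~ nu v ->
  if mono_at I v then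
    exists k : R[i],
    exists I' : {ffun circle (state_graph Gam (raise_to1 nu v)) -> 'I_n},
      [/\ k != 0, forall f, I' (circle_of _ f) = I (circle_of _ f)
        & Defs.path_map q (half_edge_state (raise_to1 nu v)) (color_basis R I)
          = k *: color_basis R I']
  else Defs.path_map q (half_edge_state (raise_to1 nu v)) (color_basis R I) = 0.
Proof.
move=> v0 q_v nuv; have memq h : (h \in q) = (end_vertex h == v).
  by rewrite (perm_mem q_v) mem_enum inE.
have -> : mono_at I v = all (mono_side I) q.
  apply/forallP/allP => Iv h; first by move: (Iv h); rewrite memq inE => /implyP.
  by apply/implyP; rewrite inE -memq; apply: Iv.
apply: path_map_color.
- case/finset.set0Pn: v0 => h; rewrite inE -memq.
  by apply: contraTneq => ->.
- by rewrite (perm_uniq q_v) enum_uniq.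
- by move=> h; rewrite memq ffunE => /eqP->.
- by move=> h; rewrite memq !ffunE.
Qed.

End Paths.

(** * The differential and its adjoint *)

Section Chains.
Variables (R : realType) (n : nat) (G : multigraph) (Gam : ribbon G).

Lemma chain_injE (nu : state G) (w : tpower R n (state_graph Gam nu)) K :
  chain_inj w (at_state K) = w K.
Proof.
rewrite /chain_inj sum_ffunE (bigD1 K) //= big1 => [|L LK].
  by rewrite !ffunE eqxx addr0 [_ *: _]mulr1.
by rewrite !ffunE /at_state eq_Tagged /= eq_sym (negbTE LK) scaler0.
Qed.

Lemma chain_inj_off (nu : state G) (w : tpower R n (state_graph Gam nu))
    (x : chain_index n Gam) : tag x != nu -> chain_inj w x = 0.
Proof.
move=> x_nu; rewrite /chain_inj sum_ffunE big1 // => K _; rewrite !ffunE.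
by case: (x =P at_state K) x_nu => [->|]; rewrite ?eqxx ?scaler0.
Qed.

Lemma chain_inj0 (nu : state G) :
  chain_inj (0 : tpower R n (state_graph Gam nu)) = 0.
Proof. by rewrite /chain_inj big1 // => K _; rewrite ffunE scale0r. Qed.

Lemma chain_injZ (nu : state G) (k : R[i]) (w : tpower R n (state_graph Gam nu)) :
  chain_inj (k *: w) = k *: chain_inj w.
Proof.
by rewrite /chain_inj scaler_sumr; apply: eq_bigr => K _; rewrite ffunE scalerA.
Qed.

Lemma chain_projK (nu : state G) (w : tpower R n (state_graph Gam nu)) :
  chain_proj nu (chain_inj w) = w.
Proof. by apply/ffunP => K; rewrite ffunE chain_injE. Qed.

Lemma chain_proj_off (nu mu : state G) (w : tpower R n (state_graph Gam nu)) :
  mu != nu -> chain_proj mu (chain_inj w) = 0.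
Proof. by move=> mu_nu; apply/ffunP => K; rewrite !ffunE chain_inj_off. Qed.

(** Makes colorings in different states comparable. *)
Definition flag_color (x : chain_index n Gam) (f : side_flag G) : 'I_n :=
  tagged x (circle_of (state_graph Gam (tag x)) f).

Lemma chain_index_eq (x y : chain_index n Gam) :
  tag x = tag y -> flag_color x =1 flag_color y -> x = y.
Proof.
case: x y => mu I [mu' J] /= mu_eq; case: mu' / mu_eq J => J IJ.
congr existT; apply/ffunP => c; case: (circle_ofP c) => f <-; exact: IJ.
Qed.

Hypothesis n_gt0 : (0 < n)%N.
Variable p : state G -> vert G -> seq (half_edge G).
Hypothesis p_path : path_choice p.
Hypothesis G_inc : forall v : vert G, halves_at v != finset.set0.

Lemma differential_color (x : chain_index n Gam) :
  exists k : vert G -> R[i], exists y : vert G -> chain_index n Gam,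
    (forall v, ~~ tag x v && mono_at (tagged x) v ->
       [/\ k v != 0, tag (y v) = raise_to1 (tag x) v
         & flag_color (y v) =1 flag_color x]) /\
    differential p (chain_color R x)
      = \sum_(v | ~~ tag x v && mono_at (tagged x) v) k v *: chain_color R (y v).
Proof.
have vP v : exists ky : R[i] * chain_index n Gam,
    ~~ tag x v && mono_at (tagged x) v ->
    [/\ ky.1 != 0, tag ky.2 = raise_to1 (tag x) v, flag_color ky.2 =1 flag_color x
      & (-1) ^+ ones_before (tag x) v *:
        chain_inj (nu := raise_to1 (tag x) v)
          (Defs.path_map (p (tag x) v) (half_edge_state (raise_to1 (tag x) v))
             (color_basis R (tagged x)))
        = ky.1 *: chain_color R ky.2].
  have [/andP[xv mono]|] := boolP (~~ tag x v && mono_at (tagged x) v); last first.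
    (* An arbitrary pair: at such a vertex the claim is vacuous. *)
    by exists (0, x).
  have := vertex_map_color R n_gt0 (tagged x) (G_inc v) (p_path (tag x) v) xv.
  rewrite mono => -[k [I' [k0 II' ->]]].
  exists ((-1) ^+ ones_before (tag x) v * k, at_state I') => _; split.
  - by rewrite mulf_neq0 // signr_eq0.
  - by [].
  - by move=> f; rewrite /flag_color /= II'.
  - by rewrite chain_injZ scalerA.
have [ky kyP] := choice vP.
exists (fun v => (ky v).1), (fun v => (ky v).2); split=> [v /kyP[]//|].
rewrite /differential (bigD1 (tag x)) //= [X in _ + X]big1 ?addr0; last first.
  move=> mu mu_x; apply: big1 => v _.
  by rewrite chain_proj_off // path_map0 chain_inj0 scaler0.
rewrite chain_projK big_mkcondr /=; apply: eq_bigr => v xv.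
case: ifP => mono; first by have [|_ _ _ ->] := kyP v; rewrite ?xv.
have := vertex_map_color R n_gt0 (tagged x) (G_inc v) (p_path (tag x) v) xv.
by rewrite mono => ->; rewrite chain_inj0 scaler0.
Qed.

Variable dot : {dot (chain R n Gam) for Num.conj}.
Hypothesis dot_color : color_orthonormal dot.

Lemma dot_color_sum (P : pred (chain_index n Gam)) (k : chain_index n Gam -> R[i]) y :
  dot (\sum_(x | P x) k x *: chain_color R x) (chain_color R y) = (P y)%:R * k y.
Proof.
rewrite linear_sumlz; transitivity (\sum_(x | P x) k x * (x == y)%:R).
  by apply: eq_bigr => x _; rewrite linearZl_LR /= dot_color.
rewrite big_mkcond (bigD1 y) //= eqxx mulr1 big1 ?addr0 => [|x /negbTE->].
  by case: ifP; rewrite ?mul1r ?mul0r.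
by rewrite mulr0; case: ifP.
Qed.

Lemma chain_color_inj : injective (@chain_color R n G Gam).
Proof.
move=> x y xy; have := dot_color x y; rewrite xy dot_color eqxx.
by case: eqP => // _ /eqP; rewrite oner_eq0.
Qed.

(** Orthonormality makes the color family free, and its size is the dimension of the chain space. *)
Lemma chain_color_span (u : chain R n Gam) :
  exists k : chain_index n Gam -> R[i], u = \sum_x k x *: chain_color R x.
Proof.
pose V := {ffun chain_index n Gam -> R[i]^o}.
pose X : #|chain_index n Gam|.-tuple V :=
  [tuple of [seq chain_color R x | x : chain_index n Gam]].
have XE (i : 'I_#|chain_index n Gam|) : X`_i = chain_color R (enum_val i).
  by rewrite nth_image.
have freeX : free X.
  apply/freeP => k k0 i.
  have := congr1 (fun w => dot w (chain_color R (enum_val i))) k0.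
  rewrite linear0l => <-; pose k' x := k (enum_rank x).
  have -> : \sum_(j < #|chain_index n Gam|) k j *: X`_j
            = \sum_x k' x *: chain_color R x.
    rewrite [RHS](reindex _ (onW_bij _ (enum_val_bij (chain_index n Gam)))) /=.
    by apply: eq_bigr => j _; rewrite XE /k' enum_valK.
  by rewrite dot_color_sum mul1r /k' enum_valK.
have basX : basis_of fullv X.
  by rewrite basisEfree freeX subvf size_tuple dimvf /= {1}/dim /= muln1.
exists (fun x => coord X (enum_rank x) (u : V)).
rewrite {1}(coord_basis basX (memvf (u : V))).
rewrite (reindex _ (onW_bij _ (enum_val_bij (chain_index n Gam)))) /=.
by apply: eq_bigr => i _; rewrite XE enum_valK.
Qed.

Variable dstar : chain R n Gam -> chain R n Gam.
Hypothesis dstar_adj : adjoint_for dot (differential p) dstar.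

(** Expanding one argument of the squared norm of [dstar (chain_color R y)] in the colors and moving
    [dstar] across gives 0, against positivity. *)
Lemma adjoint_eq0 y :
  dstar (chain_color R y) = 0 <->
  forall x, dot (differential p (chain_color R x)) (chain_color R y) = 0.
Proof.
split=> [d0 x|d0]; first by rewrite dstar_adj d0 linear0r.
apply/eqP/negPn/negP => /(@neq0_dnorm_gt0 _ _ _ dot).
have [k {1}->] := chain_color_span (dstar (chain_color R y)).
rewrite linear_sumlz big1 ?ltxx // => x _.
by rewrite linearZl_LR /= -dstar_adj d0 [LHS]mulr0.
Qed.

(** The terms for different vertices lie in different states, so they cannot cancel; pairing with
    the basis element of the term at v isolates its nonzero coefficient. *)
Lemma differential_color_eq0 (x : chain_index n Gam) :
  differential p (chain_color R x) = 0 <->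
  forall v, ~~ tag x v -> ~~ mono_at (tagged x) v.
Proof.
have [k [y [kyP ->]]] := differential_color x; split=> [d0 v xv|mono].
  apply/negP => mono; have xvm : ~~ tag x v && mono_at (tagged x) v by rewrite xv.
  have [k0 yv _] := kyP v xvm; case/eqP: k0.
  have := congr1 (fun w => dot w (chain_color R (y v))) d0.
  rewrite linear0l linear_sumlz (bigD1 v) //= linearZl_LR /= dot_color eqxx.
  rewrite [_ * _]mulr1.
  rewrite big1 ?addr0 // => w /andP[xwm w_v]; rewrite linearZl_LR /= dot_color /=.
  case: eqP => [yvw|_]; last by rewrite mulr0.
  have [_ yw _] := kyP w xwm; have := congr1 (fun nu : state G => nu w) yw.
  rewrite yvw yv !ffunE eqxx (negbTE w_v) /= => xw.
  by case/andP: xwm; rewrite xw.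
by rewrite big1 // => v /andP[/mono/negbTE->].
Qed.

Lemma mono_at_flag (x y : chain_index n Gam) v :
  flag_color x =1 flag_color y -> mono_at (tagged x) v = mono_at (tagged y) v.
Proof.
move=> xy; apply: eq_forallb => h; congr (_ ==> _).
by rewrite /mono_side -!/(flag_color _ _) !xy.
Qed.

(** If v is monochromatic and at 1, lowering it to 0 keeps the coloring meaningful, and the
    differential of the element so obtained has a nonzero component on y. Conversely, a component on
    y comes from a monochromatic vertex that has just been raised. *)
Lemma codifferential_color_eq0 (y : chain_index n Gam) :
  dstar (chain_color R y) = 0 <-> forall v, tag y v -> ~~ mono_at (tagged y) v.
Proof.
rewrite adjoint_eq0; split=> [d0 v yv|mono x].
  apply/negP => mono; pose mu : state G := [ffun u => (u != v) && tag y u].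
  (* Only edges with an end at v can change their twist, and both sides of these have the same
     color. *)
  have [//|e|J JI] := @coloring_transfer G _ (state_graph Gam mu) _ (tagged y).
    case: e => [e|o] /=; last by rewrite eqxx.
    have sideE b : end_vertex (e, b) == v ->
        tagged y (circle_of _ (inl (e, false), false)) =
        tagged y (circle_of _ (inl (e, false), true)).
      move=> ev; apply/eqP; rewrite -/(mono_side _ _) -(mono_side_edge _ e b).
      by move/forallP: mono => /(_ (e, b)); rewrite inE ev.
    case e0: (end_vertex (e, false) == v); first by move=> _; apply: sideE e0.
    case e1: (end_vertex (e, true) == v); first by move=> _; apply: sideE e1.
    by rewrite !ffunE e0 e1 eqxx.
  pose x : chain_index n Gam := at_state J.
  have xy : flag_color x =1 flag_color y by [].
  have [k [z [kzP dE]]] := differential_color x.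
  have xvm : ~~ tag x v && mono_at (tagged x) v.
    by rewrite (mono_at_flag _ xy) mono /= ffunE eqxx.
  have [k0 zv zx] := kzP v xvm.
  (* Raising v again restores the state, and the colors of the flags never changed. *)
  have zy : z v = y.
    apply: chain_index_eq => [|f]; last by rewrite zx xy.
    by rewrite zv; apply/ffunP => u; rewrite !ffunE; case: eqP => // ->.
  case/eqP: k0; have := d0 x; rewrite dE linear_sumlz (bigD1 v) //= linearZl_LR /=.
  rewrite zy dot_color eqxx [_ * _]mulr1 big1 ?addr0 // => w /andP[xwm w_v].
  rewrite linearZl_LR /= dot_color /=; case: eqP => [zw|_]; last by rewrite mulr0.
  have [_ zw' _] := kzP w xwm; have := congr1 (fun nu : state G => nu w) zw'.
  rewrite zw -zy zv !ffunE eqxx (negbTE w_v) /= => xw.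
  by case/andP: xwm; rewrite /= ffunE w_v xw.
have [k [z [kzP ->]]] := differential_color x.
rewrite linear_sumlz big1 // => w xwm; rewrite linearZl_LR /= dot_color /=.
case: eqP => [zw|_]; last by rewrite mulr0.
have [_ yw yx] := kzP w xwm; case/andP: xwm => _.
rewrite -(mono_at_flag _ yx) zw => yw_mono.
have yw1 : tag y w by rewrite -zw yw ffunE eqxx.
by have := mono w yw1; rewrite yw_mono.
Qed.

End Chains.

(** * Corners at trivalent vertices *)

Section Trivalent.
Variables (G : multigraph) (Gam : ribbon G).
Hypothesis G3 : trivalent G.
Local Notation r := (Defs.rot Gam).

Lemma trivalent_rot (h : half_edge G) :
  [/\ r (r (r h)) = h, uniq [:: h; r h; r (r h)]
    & halves_at (end_vertex h) = [set h; r h; r (r h)]%SET].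
Proof.
have ord3 : fingraph.order r h = 3%N.
  rewrite -(G3 (end_vertex h)); apply: eq_card => k.
  by rewrite !inE -[RHS]eq_sym -(rotP Gam).
have r_inj : injective r := perm_inj.
split; first by have := iter_order r_inj h; rewrite ord3.
  by have := fingraph.orbit_uniq r h; rewrite /fingraph.orbit ord3.
apply/setP => k; rewrite !inE eq_sym -(rotP Gam) fconnect_orbit /fingraph.orbit ord3.
by rewrite /= !inE orbA.
Qed.

Lemma halves_at_neq0 (v : vert G) : halves_at v != finset.set0.
Proof. by rewrite -card_gt0 (G3 v). Qed.

(** The left side of k and the right side of [r k] share a corner, so the sides of the three
    half-edges are the cyclically consecutive pairs of corners. *)
Lemma vertex_corners (n : nat) (I : {ffun circle Gam -> 'I_n}) (v : vert G) :
  exists h, exists x : 'I_n * 'I_n * 'I_n,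
  [/\ halves_at v = [set h; r h; r (r h)]%SET, uniq [:: h; r h; r (r h)],
      colors_at I v = [set x.1.1; x.1.2; x.2]%SET
    & [/\ mono_side I h = (x.2 == x.1.1), mono_side I (r h) = (x.1.1 == x.1.2)
        & mono_side I (r (r h)) = (x.1.2 == x.2)]].
Proof.
case/finset.set0Pn: (halves_at_neq0 v) => h; rewrite inE => /eqP <-.
have [r3 h_uniq hE] := trivalent_rot h.
have corner k : circle_of Gam (inl (r k), false) = circle_of Gam (inl k, true).
  exact/esym/circle_of_eq/bd_conn_corner.
exists h; exists (I (circle_of Gam (inl h, true)), I (circle_of Gam (inl (r h), true)),
          I (circle_of Gam (inl (r (r h)), true))); split=> //=.
  by rewrite /colors_at hE !imsetU !imset_set1.
by rewrite /mono_side -{1}r3 !corner.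
Qed.

Section Colors.
Variables (n : nat) (I : {ffun circle Gam -> 'I_n}) (v : vert G).

(** Three corners carry one, two or three colors, and one color means that all cyclic comparisons
    are equalities. *)
Lemma partial_mono : proper_at I v || partial_at I v = ~~ mono_at I v.
Proof.
have [h [[[x0 x1] x2] /= [hE _ cE [m0 m1 m2]]]] := vertex_corners I v.
have -> : mono_at I v = [&& x2 == x0, x0 == x1 & x1 == x2].
  rewrite -m0 -m1 -m2; apply/forallP/and3P => [mono|[h0 h1 h2] k].
    by split; apply: (implyP (mono _)); rewrite hE !inE eqxx ?orbT.
  by apply/implyP; rewrite hE !inE => /orP[/orP[]|] /eqP->.
rewrite /proper_at /partial_at cE finset.setUC cardsU1 cards2 !inE.
case: (eqVneq x0 x1) => [->|x01]; last first.
  by rewrite /= andbF; case: (x2 == x0) (x2 == x1) => -[].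
by rewrite orbb [x1 == x2]eq_sym; case: (x2 == x1).
Qed.

Lemma proper_side h : proper_at I v -> h \in halves_at v -> ~~ mono_side I h.
Proof.
have [k [[[x0 x1] x2] /= [hE _ cE [m0 m1 m2]]]] := vertex_corners I v.
rewrite /proper_at cE finset.setUC cardsU1 cards2 hE !inE.
case: (eqVneq x0 x1) => [->|x01]; first by case: (x2 == x1).
case: (eqVneq x2 x0) => //= x20; case: (eqVneq x2 x1) => //= x21 _.
by case/orP=> [/orP[]|] /eqP->; rewrite ?m0 ?m1 ?m2 // eq_sym.
Qed.

(** With exactly two colors on three corners, exactly one of the three cyclic comparisons is an
    equality. *)
Lemma partial_side :
  partial_at I v -> #|[set h in halves_at v | mono_side I h]%SET| = 1%N.
Proof.
have [k [[[x0 x1] x2] [hE h_uniq /= cE [m0 m1 m2]]]] := vertex_corners I v.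
rewrite /partial_at cE finset.setUC cardsU1 cards2 !inE => x_part.
have -> : [set h in halves_at v | mono_side I h]%SET
          = [set h in filter (mono_side I) [:: k; r k; r (r k)]]%SET.
  by apply/setP => h; rewrite hE !inE mem_filter !inE orbA andbC.
rewrite cardsE (card_uniqP (filter_uniq _ h_uniq)) /= m0 m1 m2.
case: (eqVneq x0 x1) x_part => [->|x01]; first by
  rewrite orbb [x1 == x2]eq_sym; case: (x2 == x1).
rewrite [x1 == x2]eq_sym; case: (eqVneq x2 x0) x01 => [->|_ _].
  by move/negbTE->.
by case: (x2 == x1).
Qed.

End Colors.

Lemma matching_edge n (I : {ffun circle Gam -> 'I_n}) e :
  (inl e \in induced_matching I) = mono_side I (e, false).
Proof. by rewrite inE. Qed.

End Trivalent.

(** * Induced matchings and the correspondence *)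

(** A circle without vertices is joined to nothing, so it would be a component apart from any
    vertex. *)
Lemma connected_free_edge (G : multigraph) :
  connected_graph G -> (0 < #|vert G|)%N -> free_edge G -> False.
Proof.
move=> [_ conn] /card_gt0P[v _] o; case/connectP: (conn (inr o) (inl v)).
by case=> // x q.
Qed.

Lemma proper_matching (G : multigraph) (Gam : ribbon G) (n : nat)
    (I : {ffun circle Gam -> 'I_n}) : trivalent G -> (free_edge G -> False) ->
  (forall v, proper_at I v) -> induced_matching I = finset.set0.
Proof.
move=> G3 no_free I_proper; apply/setP => -[e|o]; last by case: (no_free o).
rewrite matching_edge inE; apply/negbTE.
by apply: (proper_side G3 (I_proper (end_vertex (e, false)))); rewrite inE.
Qed.

(** Matched edges at v come from monochromatic half-edges at v, of which there is exactly one. A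
    matched loop would contribute both of its halves. *)
Lemma partial_matching (G : multigraph) (Gam : ribbon G) (n : nat)
    (I : {ffun circle Gam -> 'I_n}) : trivalent G -> (free_edge G -> False) ->
  (forall v, partial_at I v) -> perfect_matching (induced_matching I).
Proof.
move=> G3 no_free I_partial; split=> [[e|o]|v]; last first.
- have /eqP/cards1P[h hE] := partial_side G3 (I_partial v).
  have memh k : (k == h) = (end_vertex k == v) && mono_side I k.
    by rewrite -(finset.in_set1 k h) -hE !inE.
  apply/eqP/cards1P; exists (inl h.1); apply/setP => -[e|o]; last by case: (no_free o).
  rewrite !inE -[_ == _ :> 'I_n]/(mono_side I (e, false)).
  rewrite -[inl e == _]/(e == h.1); apply/andP/eqP => [[mono /orP[] ev]|->].
  + by have := memh (e, false); rewrite ev mono => /eqP<-.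
  + by have := memh (e, true); rewrite ev mono_side_edge mono => /eqP<-.
  have := memh h; rewrite eqxx => /esym/andP[hv]; case: (h) hv => e' b.
  by rewrite mono_side_edge /end_vertex /=; case: b => -> ->; rewrite ?orbT.
- by case: (no_free o).
rewrite matching_edge => mono; apply/negP => /= /eqP loop.
have /eqP/cards1P[h hE] := partial_side G3 (I_partial (ends e true)).
have memh b : (e, b) == h.
  rewrite -(finset.in_set1 _ h) -hE !inE mono_side_edge mono andbT.
  by case: b; rewrite /end_vertex /= ?loop.
by have := memh true; rewrite -(eqP (memh false)) xpair_eqE andbF.
Qed.

Theorem proposition6p21 (R : realType) (n : nat) (hn : (0 < n)%N)
    (G : multigraph) (hG3 : trivalent G) (hGc : connected_graph G)
    (Gam : ribbon G) (nu : state G)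
    (p : state G -> vert G -> seq (half_edge G)) (hp : path_choice p)
    (dot : {dot (chain R n Gam) for Num.conj}) (hdot : color_orthonormal dot)
    (dstar : chain R n Gam -> chain R n Gam)
    (hdstar : adjoint_for dot (differential p) dstar) :
  set_bij
    [set I : {ffun circle (state_graph Gam nu) -> 'I_n} |
       partial_coloring I]%classic
    (harmonic_colorings (differential p) dstar (nu := nu))
    (fun I : {ffun circle (state_graph Gam nu) -> 'I_n} => color_basis R I)
  /\ ((0 < #|vert G|)%N ->
      forall I : {ffun circle (state_graph Gam nu) -> 'I_n},
        partial_coloring I ->
        ((forall v : vert G, proper_at I v) -> induced_matching I = finset.set0)
        /\ ((forall v : vert G, partial_at I v) ->
            perfect_matching (induced_matching I))).
Proof.
have G_inc := halves_at_neq0 hG3.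
(* Each vertex is tested exactly once: by the differential if [nu] is 0 there, by the adjoint if it
   is 1. *)
have harmonicE (I : {ffun circle (state_graph Gam nu) -> 'I_n}) :
    (differential p (chain_inj (color_basis R I)) = 0 /\
     dstar (chain_inj (color_basis R I)) = 0) <-> partial_coloring I.
  have dE := differential_color_eq0 hn hp G_inc hdot (at_state I).
  have dsE := codifferential_color_eq0 hn hp G_inc hdot hdstar (at_state I).
  rewrite -/(chain_color R (at_state I)).
  split=> [[/dE d0 /dsE ds0] v|I_part].
    rewrite partial_mono //; case nuv: (nu v); first exact: ds0.
    by apply: d0; rewrite /= nuv.
  by split; [apply/dE|apply/dsE] => v _; rewrite -partial_mono.
split; last first.
  move=> V0 I _; have no_free := connected_free_edge hGc V0.
  by split; [apply: proper_matching | apply: partial_matching].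
split.
- by move=> I I_part; split; [exists I | apply/harmonicE].
(* Distinct colorings give distinct basis elements by orthonormality. *)
- move=> I J _ _ IJ; have : chain_color R (at_state I) = chain_color R (at_state J).
    by rewrite /chain_color /= IJ.
  by move/(chain_color_inj hdot)/eqP; rewrite /at_state eq_Tagged => /eqP.
- by move=> w [[I _ <-] /harmonicE I_part]; exists I.
Qed.
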